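(* Let $n\in\mathbb{N}$, $n\ge1$, and $A=\{1<\dots<n\}$. For every Chinese staircase $\sigma$, corresponding to a Chinese staircase word $w$, and every symbol $\gamma\in A$, the left-multiplication algorithm described in the context, on input $(\sigma,\gamma)$, always halts and outputs the Chinese staircase corresponding to the unique Chinese staircase word equal in $C_n$ to $\gamma w$.
   Context: The Chinese monoid of rank $n$, denoted $C_n$, is the monoid presented by $\langle A\mid \mathcal{R}\rangle$ with $A=\{1<\dots<n\}$ and $\mathcal{R}=\{(zyx,zxy),(zxy,yzx): x\le y\le z\}$, $x,y,z\in A$. A Chinese staircase word is a word $\ell^{(1)}\ell^{(2)}\cdots\ell^{(n)}$ with $\ell^{(k)}=(k1)^{\sigma_{k1}}(k2)^{\sigma_{k2}}\cdots(k(k-1))^{\sigma_{k(k-1)}}k^{\sigma_k}$, where $(kj)$ is the two-letter word with letters $k$ and $j$, and the exponents $\sigma_{kj}$ ($1\le j<k\le n$) and $\sigma_k$ ($1\le k\le n$) are non-negative integers. The corresponding Chinese staircase $\sigma$ is the array of these exponents; its $k$-th row has entries $\sigma_{k1},\dots,\sigma_{k(k-1)},\sigma_k$ in columns $1,\dots,k$, with columns indexed from right to left, and we write $\sigma_{kk}=\sigma_k$. By a known result of Cassaigne et al., every element of $C_n$ is represented by exactly one Chinese staircase word. The algorithm. Input: a Chinese staircase $\sigma$ and a symbol $\gamma\in A$. Store a symbol $\beta\in\{1,\dots,n\}\cup\{\bot\}$, initially $\bot$. First stage: iterate the following for $\rho=1,\dots,\gamma-1$. (1) If every entry in row $\rho$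 is empty (zero), do nothing for this row. (2) Otherwise let $\eta$ be the index of the rightmost non-zero entry of row $\rho$ (that is, $\eta$ is minimal with $\sigma_{\rho\eta}>0$). Then: (a) If $\beta=\bot$: (i) if $\eta<\rho$, decrement $\sigma_{\rho\eta}$ by $1$, increment $\sigma_\rho$ by $1$, and set $\beta=\eta$; (ii) if $\eta=\rho$, decrement $\sigma_\rho$ by $1$ and set $\beta=\eta$. (b) If $\beta\ne\bot$: (i) if $\eta<\beta$, decrement $\sigma_{\rho\eta}$ by $1$, increment $\sigma_{\rho\beta}$ by $1$, and (then) set $\beta=\eta$; (ii) if $\eta\ge\beta$, do nothing. Second stage, for $\rho=\gamma$: if $\beta=\bot$, increment $\sigma_\rho$ by $1$; otherwise (when $\beta\neq\bot$) increment $\sigma_{\rho\beta}$ by $1$. Finally, output the current staircase. *)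

(* Defs.v *)
From mathcomp Require Import all_boot all_algebra.

Set Implicit Arguments.
Unset Strict Implicit.
Unset Printing Implicit Defensive.

(* The alphabet A = {1 < ... < n} is 'I_n with its usual order (letter k of A
   is the ordinal of value k - 1); words are sequences over 'I_n. *)

Inductive chinese_relator n : seq 'I_n -> seq 'I_n -> Prop :=
| relator_zyx_zxy (x y z : 'I_n) of x <= y & y <= z :
    chinese_relator [:: z; y; x] [:: z; x; y]
| relator_zxy_yzx (x y z : 'I_n) of x <= y & y <= z :
    chinese_relator [:: z; x; y] [:: y; z; x].

(* The least congruence of the free monoid containing the relators, that is,
   equality in C_n of the elements represented by two words. *)
Inductive chinese_eq n : seq 'I_n -> seq 'I_n -> Prop :=
| chinese_eq_relator u v of chinese_relator u v : chinese_eq u v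
| chinese_eq_refl u : chinese_eq u u
| chinese_eq_sym u v of chinese_eq u v : chinese_eq v u
| chinese_eq_trans u v w of chinese_eq u v & chinese_eq v w : chinese_eq u w
| chinese_eq_cat u u' v v' of chinese_eq u u' & chinese_eq v v' :
    chinese_eq (u ++ v) (u' ++ v').

(* The entry s k j is sigma_kj and s k k is sigma_k; there is no column j > k
   in row k, which is encoded by zero entries above the diagonal. *)
Definition chinese_staircase n (s : 'M[nat]_n) : bool := is_trig_mx s.

Definition staircase_row_word n (s : 'M[nat]_n) (k : 'I_n) : seq 'I_n :=
  flatten [seq flatten (nseq (s k j) [:: k; j]) | j : 'I_n <- enum 'I_n & j < k]
    ++ nseq (s k k) k.

Definition staircase_word n (s : 'M[nat]_n) : seq 'I_n :=
  flatten [seq staircase_row_word s k | k <- enum 'I_n].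

Definition update_entry n (f : nat -> nat) (r c : 'I_n) (s : 'M[nat]_n) :
    'M[nat]_n :=
  \matrix_(i, j) if (i == r) && (j == c) then f (s i j) else s i j.

Definition incr_entry n := @update_entry n succn.
Definition decr_entry n := @update_entry n predn.

(* Columns are indexed from right to left, so the rightmost non-zero entry is
   the one of least index; the result is None when the row is empty. *)
Definition rightmost_nonzero n (s : 'M[nat]_n) (r : 'I_n) : option 'I_n :=
  [pick e | (0 < s r e) && [forall j, (0 < s r j) ==> (e <= j)]].

(* One iteration of the first stage, on row r; None stands for the symbol
   bottom. *)
Definition process_row n (r : 'I_n) (b : option 'I_n) (s : 'M[nat]_n) :
    option 'I_n * 'M[nat]_n :=
  match rightmost_nonzero s r, b with
  | None, _ => (b, s)
  | Some e, None =>
      if e < r then (Some e, incr_entry r r (decr_entry r e s))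
      else (Some e, decr_entry r r s)
  | Some e, Some b' =>
      if e < b' then (Some e, incr_entry r b' (decr_entry r e s))
      else (b, s)
  end.

Definition process_last_row n (g : 'I_n) (b : option 'I_n) (s : 'M[nat]_n) :
    'M[nat]_n :=
  match b with
  | None => incr_entry g g s
  | Some b' => incr_entry g b' s
  end.

(* Running rs b s: the rows rs remain to be treated by the first stage, in this
   order, the stored symbol is b and the current staircase is s. *)
Inductive config n :=
| Running of seq 'I_n & option 'I_n & 'M[nat]_n
| Halted of 'M[nat]_n.
Arguments Halted {n}.

Definition initial_config n (s : 'M[nat]_n) (g : 'I_n) : config n :=
  Running [seq r : 'I_n <- enum 'I_n | r < g] None s.

Definition step n (g : 'I_n) (c : config n) : config n :=
  match c with
  | Running (r :: rs) b s =>
      let: (b', s') := process_row r b s in Running rs b' s'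
  | Running [::] b s => Halted (process_last_row g b s)
  | Halted s => Halted s
  end.

Definition halts_with_output n (s : 'M[nat]_n) (g : 'I_n) (t : 'M[nat]_n) :
    Prop :=
  exists k : nat, iter k (step g) (initial_config s g) = Halted t.

(* Main.v *)
Require Import Defs.
From mathcomp Require Import all_boot all_algebra.
From mathcomp Require Import zify.

Set Implicit Arguments.
Unset Strict Implicit.
Unset Printing Implicit Defensive.

(** Carrying the letter [g] through a row [r < g] of the staircase word leaves
    behind either [g] itself or a pair [g c], and the symbol stored by the
    algorithm records which.  This rests on the fact that, for [x <= z], the word
    [z x] commutes with every letter [y] such that [x <= y <= z]; hence two
    words [z x] and [y w] with nested intervals commute, and a row word is the
    commuting product of a multiset of blocks [r j] and [r].  So a row may be
    treated as a function counting its entries, and one iteration of the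
    algorithm as follows: add the incoming symbol to the row (the bottom symbol
    adds a diagonal entry), then extract the least entry, which becomes the
    outgoing symbol; bottom goes unchanged through an empty row.  Following the
    exchange [gc.rm = rc.gm] through the rows ([rows_word_insert]) shows that
    the output word represents [g w].

    It remains to see that a class contains at most one staircase word.  The
    algorithm itself proves this.  Letting each letter act on staircases by
    running the algorithm gives an action of the Chinese monoid
    ([act_chinese_eq]), and the word of a staircase acts on the empty staircase
    by producing that staircase ([act_rows_word]); so congruent staircase words
    come from the same staircase ([staircase_word_inj]).

    For the action property one compares, row by row, three consecutive runs of
    the algorithm for [x <= y <= z].  The symbols that they carry stay sorted,
    bottom being the greatest ([carry_sorted]).  Before row [x] the runs do the
    same whichever word is read.  At row [x] one run stops.  Exchanging it with
    the next one changes nothing ([carry_add]), except when the row is empty and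
    every symbol is bottom; then the two surviving symbols are merely swapped.
    From there on swapped symbols yield the same rows, and either the same or
    again swapped symbols ([carry_swap]), until the second run stops at row [y].
    This settles [zyx = zxy].  For [zyx = yzx], the runs exchanged are those at
    row [y], where the exceptional case cannot occur any more: the run stopped
    at row [x] has left an entry there, so the next one carries a proper symbol
    from then on. *)

(** * One row of the algorithm *)

(* A staircase is the list of its rows, tagged by their index, so that several
   runs of the algorithm can be compared by induction on the list. *)
Local Notation srow n := {ffun 'I_n -> nat}.
Local Notation srows n := (seq ('I_n * srow n)).

Definition add_entry n (f : srow n) (c : 'I_n) : srow n :=
  [ffun j => f j + (j == c)].

Definition empty_row n : srow n := [ffun=> 0].

Definition lowest n (f : srow n) : option 'I_n :=
  [pick e | (0 < f e) && [forall j, (0 < f j) ==> (e <= j)]].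

(** The outgoing symbol.  A stored symbol [c] enters the row in column [c], and
    the bottom symbol, [None], enters it in the diagonal column: [odflt r b] is
    that column in both cases. *)
Definition carry n (r : 'I_n) (f : srow n) (b : option 'I_n) :=
  if (b == None) && (f == empty_row n) then None
  else lowest (add_entry f (odflt r b)).

(** What a symbol takes away from row [r] on leaving it.  A diagonal entry stands
    for one letter [r], hence half of a pair: bottom costs one of them and the
    symbol [r] two.  With this convention the number of entries is conserved. *)
Definition weight n (r : 'I_n) (b : option 'I_n) (j : 'I_n) : nat :=
  (j == odflt r b) + ((b == Some r) && (j == r)).

Definition residue n (r : 'I_n) (f : srow n) (b : option 'I_n) : srow n :=
  [ffun j => add_entry f (odflt r b) j - weight r (carry r f b) j].

Definition below n (k : nat) (b : option 'I_n) : bool :=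
  if b is Some c then c < k else true.

(** The order on symbols, for which bottom is the greatest element. *)
Definition state_le n (a b : option 'I_n) : bool :=
  if b is Some d then (if a is Some c then c <= d else false) else true.

Lemma add_entryC n (f : srow n) (c d : 'I_n) :
  add_entry (add_entry f c) d = add_entry (add_entry f d) c.
Proof. by apply/ffunP => j; rewrite !ffunE addnAC. Qed.

Lemma add_entry_neq0 n (f : srow n) (c : 'I_n) :
  add_entry f c == empty_row n = false.
Proof. by apply/eqP => /ffunP /(_ c); rewrite !ffunE eqxx addn1. Qed.

Lemma lowestE n (f : srow n) (m : 'I_n) :
  0 < f m -> (forall j : 'I_n, 0 < f j -> m <= j) -> lowest f = Some m.
Proof.
move=> fm mmin; rewrite /lowest; case: pickP => [e /andP[fe /forallP emin]|/(_ m)].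
  congr Some; apply/val_inj/eqP; rewrite eqn_leq mmin // andbT.
  exact: (implyP (emin m)).
by rewrite fm /=; case: forallP => // -[] j; apply/implyP; apply: mmin.
Qed.

Variant lowest_spec n (f : srow n) : option 'I_n -> Prop :=
| LowestNone of f = empty_row n : lowest_spec f None
| LowestSome m of 0 < f m & (forall j : 'I_n, 0 < f j -> m <= j) :
    lowest_spec f (Some m).

Lemma lowestP n (f : srow n) : lowest_spec f (lowest f).
Proof.
have [j fj|f0] := pickP (fun j => 0 < f j); last first.
  rewrite /lowest; case: pickP => [e /andP[]|_]; first by rewrite f0.
  by constructor; apply/ffunP => j; rewrite ffunE; have := f0 j; case: (f j).
have [m fm mmin] := @arg_minnP _ j (fun j => 0 < f j) (@nat_of_ord n) fj.
by rewrite (lowestE fm mmin); constructor.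
Qed.

(** An entry that is not less than one already present cannot become the least
    one: this is why the order of an insertion and an extraction is mostly
    irrelevant. *)
Lemma lowest_add n (f : srow n) (c d : 'I_n) :
  c <= d -> lowest (add_entry (add_entry f c) d) = lowest (add_entry f c).
Proof.
move=> cd; case: (lowestP (add_entry f c)) => [/eqP|m fm mmin].
  by rewrite add_entry_neq0.
apply: lowestE => [|j]; first by rewrite ffunE ltn_addr.
rewrite [X in 0 < X]ffunE; case: eqP => [->|_ h]; last by apply: mmin; lia.
by move=> _; apply: leq_trans cd; apply: mmin; rewrite ffunE eqxx; lia.
Qed.

Variant carry_spec n (r : 'I_n) (f : srow n) (b : option 'I_n) :
  option 'I_n -> Prop :=
| CarryNone of b = None & f = empty_row n : carry_spec r f b None
| CarrySome m of (b != None) || (f != empty_row n) & 0 < add_entry f (odflt r b) m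
    & (forall j : 'I_n, 0 < add_entry f (odflt r b) j -> m <= j) :
    carry_spec r f b (Some m).

Lemma carryP n (r : 'I_n) (f : srow n) (b : option 'I_n) :
  carry_spec r f b (carry r f b).
Proof.
rewrite /carry; case: ifP => [/andP[/eqP -> /eqP ->]|]; first by constructor.
move=> /negbT; rewrite negb_and => h.
case: lowestP => [/eqP|m fm mmin]; first by rewrite add_entry_neq0.
by constructor.
Qed.

Lemma carry_le n (r : 'I_n) (f : srow n) (b : option 'I_n) m :
  carry r f b = Some m -> m <= odflt r b.
Proof.
case: carryP => // p _ _ mmin [<-]; apply: mmin.
by rewrite ffunE eqxx addn1.
Qed.

Lemma carry_below n (r : 'I_n) (f : srow n) (b : option 'I_n) :
  below r b -> below r.+1 (carry r f b).
Proof.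
case E: carry => [m|] //=; have := carry_le E.
by case: b {E} => [c|] /= mc br; lia.
Qed.

(** The subtraction in [residue] never truncates: conservation of the entries of
    a row together with the symbols that enter and leave it.  The delicate case
    is the symbol [r], which costs two diagonal entries: the incoming symbol is
    then bottom, which supplies one, and the row, being nonempty with no entry
    in a smaller column, supplies the other. *)
Lemma residueK n (r : 'I_n) (f : srow n) (b : option 'I_n) (j : 'I_n) :
  below r b -> (forall i : 'I_n, 0 < f i -> i <= r) ->
  residue r f b j + weight r (carry r f b) j = add_entry f (odflt r b) j.
Proof.
move=> br supp; rewrite ffunE subnK // /weight.
case: carryP => [-> -> /=|m h fm mmin /=]; first by rewrite !ffunE addn0 leq_addl.
case: (j =P m) => [->|jm]; last first.
  by rewrite add0n; case: eqP => //= -[mr]; case: eqP jm => // -> []; rewrite mr.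
case: (Some m =P Some r) => [[mr]|_]; last by rewrite addn0.
rewrite mr eqxx; case: b br h fm mmin => [c|] /= cr h fm mmin.
  by have := mmin c; rewrite !ffunE eqxx mr; lia.
have [i fi]: exists i, 0 < f i.
  apply/existsP; apply: contraR h; rewrite negb_exists => /forallP f0.
  by apply/eqP/ffunP => i; rewrite ffunE; have := f0 i; case: (f i).
have ri: r <= i by rewrite -mr; apply: mmin; rewrite ffunE; lia.
have ir : i = r by apply/val_inj/eqP; rewrite eqn_leq supp.
by move: fi; rewrite ir ffunE eqxx; lia.
Qed.

(** Once the least entry has been extracted nothing left in the row is smaller, so
    that a later run which brings in a symbol no smaller than the first one also
    takes out a symbol no smaller. *)
Lemma carry_sorted n (r : 'I_n) (f : srow n) (a b : option 'I_n) :
  below r a -> state_le a b -> state_le (carry r f a) (carry r (residue r f a) b).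
Proof.
move=> ar ab; case: (carryP r (residue r f a) b) => // q h2 fq qmin.
case E: (carry r f a) => [m|] /=; last first.
  move: E h2; case: carryP => // ? -> _; subst a; case: b ab fq qmin => //= _ fq qmin.
  case/eqP; apply/ffunP => j; rewrite !ffunE /weight /carry !eqxx /= add0n addn0.
  by rewrite subnn.
move: fq; rewrite ffunE; case: eqP => [-> _|_].
  apply: (leq_trans (carry_le E)).
  by case: a b ar ab {E qmin h2} => [c|] [d|] //= cr; lia.
rewrite addn0 ffunE => fq.
move: E; case: carryP => // m' _ _ mmin [<-]; apply: mmin; lia.
Qed.

(** Of two runs with sorted symbols, it does not matter which one stops at a row
    and which one goes through, by [lowest_add].  Only an empty row
    met by bottom must be set aside: it lets bottom through, whereas the
    diagonal entry left by a stop is extracted. *)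
Lemma carry_add n (r : 'I_n) (f : srow n) (a b : option 'I_n) :
  below r a -> state_le a b -> (a != None) || (f != empty_row n) ->
  carry r (add_entry f (odflt r a)) b = carry r f a.
Proof.
move=> ar ab h; rewrite /carry add_entry_neq0 andbF lowest_add; last first.
  by case: a b ar ab {h} => [c|] [d|] //= cr; lia.
by rewrite -[RHS]if_neg negb_and h.
Qed.

Lemma residue_add n (r : 'I_n) (f : srow n) (a b : option 'I_n) :
  below r a -> state_le a b -> (a != None) || (f != empty_row n) ->
  (forall i : 'I_n, 0 < f i -> i <= r) ->
  residue r (add_entry f (odflt r a)) b = add_entry (residue r f a) (odflt r b).
Proof.
move=> ar ab h supp; apply/ffunP => j.
rewrite ffunE carry_add // [RHS]ffunE ffunE -(residueK j ar supp); lia.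
Qed.

Lemma carry_addC n (r : 'I_n) (f : srow n) (a b : option 'I_n) :
  carry r (add_entry f (odflt r a)) b = carry r (add_entry f (odflt r b)) a.
Proof. by rewrite /carry !add_entry_neq0 !andbF add_entryC. Qed.

Lemma residue_addC n (r : 'I_n) (f : srow n) (a b : option 'I_n) :
  residue r (add_entry f (odflt r a)) b = residue r (add_entry f (odflt r b)) a.
Proof. by apply/ffunP => j; rewrite !ffunE carry_addC; lia. Qed.

Lemma carry_empty n (r : 'I_n) b : below r b -> carry r (empty_row n) b = b.
Proof.
case: b => [c|] cr; rewrite /carry ?eqxx //=; apply: lowestE => [|j].
  by rewrite !ffunE eqxx.
by rewrite !ffunE; case: eqP => // ->.
Qed.

Lemma residue_empty n (r : 'I_n) b :
  below r b -> residue r (empty_row n) b = empty_row n.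
Proof.
move=> br; apply/ffunP => j; rewrite !ffunE carry_empty // /weight.
case: b br => [c|] /= cr; last by rewrite addn0 subnn.
have -> : (Some c == Some r) = false; last by rewrite addn0 subnn.
by apply/eqP => -[E]; move: cr; rewrite E ltnn.
Qed.

(** If the row has an entry at most the smaller symbol, both orders extract the
    least one first and then the same second entry; otherwise the smaller symbol
    goes straight through in either order, and the outputs are swapped. *)
Lemma carry_swap n (r : 'I_n) (f : srow n) (a b : option 'I_n) :
  below r a -> below r b -> state_le a b ->
  residue r (residue r f b) a = residue r (residue r f a) b /\
  ((carry r f b, carry r (residue r f b) a) =
     (carry r f a, carry r (residue r f a) b) \/
   (carry r f b, carry r (residue r f b) a) =
     (carry r (residue r f a) b, carry r f a)).
Proof.
move=> ar br ab.
have [->|nab] := eqVneq a b; first by split; [|left].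
case: a ar ab nab => [c|] /=; last by case: b br.
move=> cr cb nab.
have cd : c < odflt r b.
  case: b br cb nab => [d|] //= _ cd.
  by rewrite ltn_neqAle cd andbT; apply: contra => /eqP/val_inj->.
have [/andP[/eqP ? /eqP ?]|h] := boolP ((b == None) && (f == empty_row n)).
  subst b f.
  by rewrite !(residue_empty, carry_empty) //; split; [|right].
case Eb: (carry r f b) => [m|]; last first.
  by move: Eb h; case: carryP => // -> ->; rewrite !eqxx.
have [fm mmin] : 0 < add_entry f (odflt r b) m /\
    forall j : 'I_n, 0 < add_entry f (odflt r b) j -> m <= j.
  by move: Eb; case: carryP => // m' _ h1 h2 [<-].
(* m is the least among the entries of the row and the greater symbol b *)
have [mc|cm] := leqP m c.
  have fm' : 0 < f m.
    by move: fm; rewrite ffunE; case: eqP => [E|]; [move: mc; rewrite E; lia|lia].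
  have Ea : carry r f (Some c) = Some m.
    rewrite /carry /=; apply: lowestE => [|j]; rewrite ffunE; first by lia.
    by case: eqP => [-> //|_]; rewrite addn0 => fj; apply: mmin; rewrite ffunE; lia.
  have mr' : (Some m == Some r) = false by apply/eqP => -[E]; move: mc; rewrite E; lia.
  have e : add_entry (residue r f (Some c)) (odflt r b)
         = add_entry (residue r f b) c.
    apply/ffunP => j; rewrite !ffunE Ea Eb /weight mr' /= addn0.
    by case: (j =P m) => [->|_]; lia.
  have e2 : carry r (residue r f b) (Some c) = carry r (residue r f (Some c)) b.
    rewrite /carry /= -e; case: ifP => // /andP[_ /eqP/ffunP/(_ c)].
    rewrite !ffunE Ea /weight mr' /= eqxx.
    by case: (c =P m) => [E|]; [move: fm'; rewrite -E|]; lia.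
  rewrite e2 Ea; split; last by left.
  by apply/ffunP => j; rewrite ffunE /= -e e2 [RHS]ffunE.
have Ea : carry r f (Some c) = Some c.
  rewrite /carry /=; apply: lowestE => [|j]; rewrite ffunE ?eqxx ?addn1 //.
  case: eqP => [-> //|_]; rewrite addn0 => fj; apply: ltnW; apply: leq_trans cm _.
  by apply: mmin; rewrite ffunE; lia.
have keep g : carry r g (Some c) = Some c -> residue r g (Some c) = g.
  move=> Eg; apply/ffunP => j; rewrite !ffunE Eg /weight /=.
  have -> : (Some c == Some r) = false.
    by apply/eqP => -[E]; move: cr; rewrite E ltnn.
  by rewrite addn0 addnK.
have Ea' : carry r (residue r f b) (Some c) = Some c.
  rewrite /carry /=; apply: lowestE => [|j]; rewrite ffunE ?eqxx ?addn1 //.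
  case: eqP => [-> //|_]; rewrite addn0 ffunE => fj; apply: ltnW; apply: leq_trans cm _.
  by apply: mmin; lia.
by rewrite (keep _ Ea) (keep _ Ea') Ea Ea' Eb; split; [|right].
Qed.

(** * Left multiplication is an action of the Chinese monoid *)

(** A run of the algorithm for [g], started with the symbol [b] on the rows [l]
    that remain to be treated. *)
Fixpoint insert n (g : 'I_n) (b : option 'I_n)
    (l : srows n) :=
  if l is (r, f) :: l' then
    if r < g then (r, residue r f b) :: insert g (carry r f b) l'
    else if r == g then (r, add_entry f (odflt r b)) :: l'
    else l
  else [::].

(** The list [l] consists of all the rows from [k] on, and no row has entries
    beyond the diagonal. *)
Fixpoint rows_from n (k : nat) (l : srows n) : bool :=
  if l is (r, f) :: l' then
    [&& k == r, [forall i, (0 < f i) ==> (i <= r)] & rows_from k.+1 l']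
  else k == n.

Lemma rows_from_cons n k (r : 'I_n) f l :
  rows_from k ((r, f) :: l) ->
  [/\ k = r, forall i : 'I_n, 0 < f i -> i <= r & rows_from r.+1 l].
Proof.
by move=> /= /and3P[/eqP <- /forallP h ->]; split=> // i; apply/implyP.
Qed.

Lemma supp_add n (r : 'I_n) (f : srow n) (b : option 'I_n) :
  below r b -> (forall i : 'I_n, 0 < f i -> i <= r) ->
  forall i : 'I_n, 0 < add_entry f (odflt r b) i -> i <= r.
Proof.
move=> br supp i; rewrite ffunE; case: eqP => [-> _|_]; last by rewrite addn0; apply: supp.
by case: b br => [c /ltnW|].
Qed.

Lemma supp_residue n (r : 'I_n) (f : srow n) (b : option 'I_n) :
  below r b -> (forall i : 'I_n, 0 < f i -> i <= r) ->
  forall i : 'I_n, 0 < residue r f b i -> i <= r.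
Proof.
move=> br supp i ri; apply: (supp_add br supp).
by rewrite -(residueK i br supp) ltn_addr.
Qed.

Lemma rows_from_insert n k (g : 'I_n) b l :
  below k b -> rows_from k l -> rows_from k (insert g b l).
Proof.
elim: l k b => [//|[r f] l IH] k b bk /rows_from_cons[kr supp okl]; subst k.
rewrite /insert -/insert; case: ifP => [rg|_].
  apply/and3P; split=> //; last by apply: IH => //; apply: carry_below.
  by apply/forallP => i; apply/implyP; apply: supp_residue.
case: ifP => _; apply/and3P; split=> //; apply/forallP => i; apply/implyP.
  exact: supp_add.
exact: supp.
Qed.

(** Swapped symbols reach row [y] swapped or not, by [carry_swap]; there both are
    added to the row before the least entry is extracted. *)
Lemma insert_swap n k (y z : 'I_n) (a b : option 'I_n) l :
  k <= y -> y <= z -> rows_from k l -> below k a -> below k b ->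
  insert z b (insert y a l) = insert z a (insert y b l).
Proof.
move=> + yz; elim: l k a b => [|[r f] l IH] k a b ky okl ak bk.
  by move: okl ky => /= /eqP->; have := ltn_ord y; lia.
have [kr supp okl'] := rows_from_cons okl; subst k.
have [ry|yr] := ltnP r y.
  have rz := leq_trans ry yz; do 2 rewrite /= ?ry ?rz.
  have sw : state_le a b || state_le b a by case: (a) (b) => [c|] [d|] //=; apply: leq_total.
  wlog ab : a b ak bk {sw} / state_le a b.
    by move=> W; case/orP: sw => h; [apply: W|symmetry; apply: W].
  have [-> [[-> ->]//|[-> ->]]] := carry_swap f ak bk ab.
  by congr cons; apply: (IH r.+1) => //; apply: carry_below.
have {yr ky} ry : r = y by apply/val_inj/eqP; rewrite eqn_leq ky.
subst r; rewrite /= ltnn eqxx /=; case: (ltngtP y z) yz => // yz _.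
  by rewrite residue_addC carry_addC.
by rewrite (val_inj yz) eqxx add_entryC.
Qed.

(** At row [y], the run that stops and the run that goes through are exchanged by
    [carry_add].  The last hypothesis excludes its exceptional case and is
    inherited by the following rows: a row that is nonempty, or entered by a
    proper symbol, lets a proper symbol out. *)
Lemma insert_yzx n k (y z : 'I_n) (a b : option 'I_n) l :
  k <= y -> y <= z -> rows_from k l -> below k a -> state_le a b ->
  (a != None) || (if l is (_, f) :: _ then f != empty_row n else false) ->
  insert z b (insert y a l) = insert y b (insert z a l).
Proof.
move=> + yz; elim: l k a b => [|[r f] l IH] k a b ky okl ak ab h.
  by move: okl ky => /= /eqP->; have := ltn_ord y; lia.
have [kr supp okl'] := rows_from_cons okl; subst k.
have [ry|yr] := ltnP r y.
  have rz := leq_trans ry yz; do 2 rewrite /= ?ry ?rz.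
  congr cons; apply: (IH r.+1) => //; first exact: carry_below.
    exact: carry_sorted.
  by case: carryP h => // -> ->; rewrite !eqxx.
have {yr ky} ry : r = y by apply/val_inj/eqP; rewrite eqn_leq ky.
subst r; rewrite /= ltnn eqxx /=; case: (ltngtP y z) yz => // yz _.
  by rewrite /= ltnn eqxx residue_add // carry_add.
by rewrite (val_inj yz) !eqxx /= ltnn eqxx.
Qed.

(** After the first run has stopped at row [x] this row is nonempty, which puts
    the other two under [insert_yzx]. *)
Lemma insert_zyx_yzx n k (x y z : 'I_n) (a b c : option 'I_n) l :
  k <= x -> x <= y -> y <= z -> rows_from k l -> below k a -> below k b ->
  state_le a b -> state_le b c ->
  insert z c (insert y b (insert x a l)) = insert y c (insert z b (insert x a l)).
Proof.
move=> + xy yz; elim: l k a b c => [//|[r f] l IH] k a b c kx okl ak bk ab bc.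
have [kr supp okl'] := rows_from_cons okl; subst k.
have [rx|xr] := ltnP r x.
  have ry := leq_trans rx xy; have rz := leq_trans ry yz.
  do 3 rewrite /= ?rx ?ry ?rz.
  congr cons; apply: (IH r.+1) => //; try exact: carry_below.
    exact: carry_sorted.
  exact: carry_sorted.
have {xr kx} rx : r = x by apply/val_inj/eqP; rewrite eqn_leq kx.
subst r; apply: (@insert_yzx _ x) => //; first exact: rows_from_insert.
by rewrite /= ltnn eqxx add_entry_neq0 orbT.
Qed.

Lemma carry_single n (r c : 'I_n) b :
  c <= odflt r b -> carry r (add_entry (empty_row n) c) b = Some c.
Proof.
move=> cb; rewrite /carry add_entry_neq0 andbF lowest_add //.
apply: lowestE => [|j]; rewrite !ffunE ?eqxx //; case: eqP => // -> //.
Qed.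

Lemma residue_single n (r : 'I_n) :
  residue r (add_entry (empty_row n) r) None = empty_row n.
Proof.
apply/ffunP => j; rewrite !ffunE carry_single // /weight /= eqxx /=.
by rewrite add0n subnn.
Qed.

(** At row [x] the first two runs are exchanged by [carry_add]; in its exceptional
    case the last two runs leave row [x] with the symbols [x] and bottom, in one
    order or the other, and [insert_swap] concludes. *)
Lemma insert_zyx_zxy n k (x y z : 'I_n) (a b c : option 'I_n) l :
  k <= x -> x <= y -> y <= z -> rows_from k l -> below k a -> below k b ->
  state_le a b -> state_le b c ->
  insert z c (insert y b (insert x a l)) = insert z c (insert x b (insert y a l)).
Proof.
move=> + xy yz; have [/val_inj->//|nxy] := eqVneq (x : nat) y.
have {nxy xy} xy : x < y by rewrite ltn_neqAle nxy.
elim: l k a b c => [//|[r f] l IH] k a b c kx okl ak bk ab bc.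
have [kr supp okl'] := rows_from_cons okl; subst k.
have [rx|xr] := ltnP r x.
  have ry := ltn_trans rx xy; have rz := leq_trans ry yz.
  do 3 rewrite /= ?rx ?ry ?rz.
  congr cons; apply: (IH r.+1) => //; try exact: carry_below.
    exact: carry_sorted.
  exact: carry_sorted.
have {xr kx} rx : r = x by apply/val_inj/eqP; rewrite eqn_leq kx.
subst r; have xz := leq_trans xy yz; do 3 rewrite /= ?ltnn ?eqxx ?xy ?xz.
have [h|] := boolP ((a != None) || (f != empty_row n)).
  by rewrite (residue_add ak ab h supp) (carry_add ak ab h).
rewrite negb_or !negbK => /andP[/eqP ? /eqP ?]; subst a f.
case: b ab bc {bk} => // _; case: c => // _.
rewrite /= !(residue_empty, carry_empty, carry_single, residue_single) //.
congr cons; apply: (@insert_swap _ x.+1) => //=.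
Qed.

(** * A staircase is recovered from its word *)

Definition act n (w : seq 'I_n) (l : srows n) :=
  foldr (fun g => insert g None) l w.

(** The word of an entry in column [j] of row [r].  Columns beyond the diagonal
    get the diagonal word, so that blocks of one row commute unconditionally. *)
Definition block n (r j : 'I_n) : seq 'I_n := if j < r then [:: r; j] else [:: r].

Definition columns n (f : srow n) : seq 'I_n :=
  flatten [seq nseq (f j) j | j <- enum 'I_n].

Definition row_word n (r : 'I_n) (f : srow n) : seq 'I_n :=
  flatten [seq block r j | j <- columns f].

Definition rows_word n (l : srows n) : seq 'I_n :=
  flatten [seq row_word p.1 p.2 | p <- l].

Definition clear n (l : srows n) :=
  [seq (p.1, empty_row n) | p <- l].

Definition add_columns n (k : 'I_n) (cs : seq 'I_n)
    (l : srows n) :=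
  [seq if p.1 == k
       then (p.1, [ffun j => (p.2 : srow n) j + count_mem j cs] : srow n)
       else p | p <- l].

Definition empty_before n (k : nat) (l : srows n) :=
  all (fun p : 'I_n * srow n => (p.1 < k) ==> (p.2 == empty_row n)) l.

Lemma act_cat n (u v : seq 'I_n) l : act (u ++ v) l = act u (act v l).
Proof. exact: foldr_cat. Qed.

Lemma rows_from_act n k (w : seq 'I_n) l : rows_from k l -> rows_from k (act w l).
Proof. by move=> okl; elim: w => //= g w; apply: rows_from_insert. Qed.

Lemma act_chinese_eq n (u v : seq 'I_n) :
  chinese_eq u v -> forall l, rows_from 0 l -> act u l = act v l.
Proof.
elim=> {u v} [u v [x y z xy yz|x y z xy yz]|u|u v _ IH|u v w _ IH1 _ IH2
             |u u' v v' _ IH1 _ IH2] l okl //=.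
- exact: (@insert_zyx_zxy _ 0).
- rewrite -(@insert_zyx_zxy _ 0) //; exact: (@insert_zyx_yzx _ 0).
- by rewrite IH.
- by rewrite IH1 // IH2.
- by rewrite !act_cat IH2 // IH1 // rows_from_act.
Qed.

Lemma count_columns n (f : srow n) j : count_mem j (columns f) = f j.
Proof.
rewrite /columns count_flatten -map_comp sumnE big_map big_enum /=.
rewrite (bigD1 j) //= count_nseq /= eqxx mul1n big1 ?addn0 // => i /negPf ij.
by rewrite count_nseq /= ij.
Qed.

Lemma rows_from_tags n k (l : srows n) :
  rows_from k l -> [seq val p.1 | p <- l] = iota k (size l).
Proof.
elim: l k => //= -[r f] l IH k okl.
by have [-> _ /IH->] := rows_from_cons okl.
Qed.

Lemma add_columns_out n (k : 'I_n) cs l :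
  k \notin [seq p.1 | p <- l] -> add_columns k cs l = l.
Proof.
elim: l => //= p l IH; rewrite inE negb_or => /andP[kp /IH->].
by rewrite eq_sym (negPf kp).
Qed.

Lemma rows_from_ge n m (l : srows n) q :
  rows_from m l -> q \in l -> m <= q.1.
Proof.
move=> okl ql; have : val q.1 \in [seq val p.1 | p <- l] by apply: map_f.
by rewrite (rows_from_tags okl) mem_iota => /andP[].
Qed.

Lemma rows_from_notin n (k : 'I_n) m l :
  rows_from m l -> k < m -> k \notin [seq p.1 | p <- l].
Proof.
move=> okl km; apply/mapP => -[q /(rows_from_ge okl) + kq].
by rewrite -kq leqNgt km.
Qed.

(** A symbol goes unchanged through empty rows. *)
Lemma insert_empty_before n m (k : 'I_n) b l :
  m <= k -> below m b -> rows_from m l -> empty_before k l ->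
  insert k b l = add_columns k [:: odflt k b] l.
Proof.
elim: l m => [//|[r f] l IH] m mk bm okl /= /andP[rf eb].
have [mr supp okl'] := rows_from_cons okl; subst m.
have [rk|kr] := ltnP r k.
  move: rf; rewrite rk /= => /eqP->.
  rewrite residue_empty // carry_empty // (IH r.+1) //; last first.
    by case: b bm {IH} => //= c /ltnW.
  by case: eqP rk => // ->; rewrite ltnn.
have {kr mk} rk : r = k by apply/val_inj/eqP; rewrite eqn_leq mk.
subst r; rewrite eqxx -/(add_columns _ _ _) add_columns_out; last first.
  exact: rows_from_notin okl' _.
by congr ((_, _) :: _); apply/ffunP => j; rewrite !ffunE /= addn0 eq_sym.
Qed.

(** When the rows before [k] are empty, the letter [j] leaves a diagonal entry in
    row [j], which the letter [k] then carries off to row [k]. *)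
Lemma act_block n m (k j : 'I_n) l :
  m <= j -> j <= k -> rows_from m l -> empty_before k l ->
  act (block k j) l = add_columns k [:: j] l.
Proof.
rewrite /block => mj; case: ltngtP => // [jk _|/val_inj jk _]; last first.
  by subst j => okl eb; rewrite /= (insert_empty_before mj).
elim: l m mj => [//|[r f] l IH] m mj okl /= /andP[rf eb].
have [mr supp okl'] := rows_from_cons okl; subst m.
have rk := leq_ltn_trans mj jk; rewrite rk /= in rf; move/eqP: rf => ->.
have rk' : r == k = false by apply/eqP => E; move: rk; rewrite E ltnn.
have [rj|jr] := ltnP r j.
  rewrite residue_empty // carry_empty //= rk residue_empty // carry_empty // rk'.
  congr cons.
  exact: (IH r.+1).
have {jr mj} rj : r = j by apply/val_inj/eqP; rewrite eqn_leq mj.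
subst r; rewrite eqxx /= rk rk' residue_single carry_single //; congr cons.
by apply: (@insert_empty_before _ j.+1) => //=.
Qed.

Lemma act_blocks n (k : 'I_n) cs l :
  all (fun j : 'I_n => j <= k) cs -> rows_from 0 l -> empty_before k l ->
  act (flatten [seq block k j | j <- cs]) l = add_columns k cs l.
Proof.
move=> + okl eb; elim: cs => [_|j cs IH /= /andP[jk /IH{}IH]].
  rewrite /add_columns -[LHS]map_id; apply: eq_map => -[r f] /=.
  by case: eqP => // _; congr pair; apply/ffunP => j; rewrite ffunE addn0.
rewrite act_cat IH (@act_block _ 0) //.
- rewrite /add_columns -map_comp; apply: eq_map => -[r f] /=.
  case: (eqVneq r k) => [->|/negPf rk] /=; last by rewrite rk.
  rewrite eqxx; congr pair; apply/ffunP => i; rewrite !ffunE /=; lia.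
- by rewrite -IH rows_from_act.
rewrite /empty_before all_map; apply/allP => -[r f] /(allP eb) /=.
by case: (r =P k) => //= ->; rewrite ltnn.
Qed.

Lemma rows_from_clear n k (l : srows n) : rows_from k l -> rows_from k (clear l).
Proof.
elim: l k => //= -[r f] l IH k /and3P[-> _ /IH->]; rewrite andbT.
by apply/forallP => i; rewrite ffunE.
Qed.

Lemma rows_from_cat n k (p l : srows n) :
  rows_from k (p ++ l) -> rows_from (k + size p) l.
Proof.
elim: p k => [|[r f] p IH] k; first by rewrite addn0.
by case/rows_from_cons => -> _ /IH; rewrite addnS.
Qed.

(** Reading from right to left, each row word is read while all rows before it are
    still empty, and fills its own row only. *)
Lemma act_rows_word n (p l : srows n) :
  rows_from 0 (p ++ l) -> act (rows_word l) (clear (p ++ l)) = clear p ++ l.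
Proof.
elim: l p => [|[r f] l IH] p okl; first by rewrite /= !cats0.
have okc : rows_from 0 (clear (p ++ (r, f) :: l)).
  exact: rows_from_clear.
have [_ supp okl'] := rows_from_cons (rows_from_cat okl).
have tags := rows_from_tags okl.
rewrite map_cat /= in tags.
have [rp rl] : r \notin [seq q.1 | q <- p] /\ r \notin [seq q.1 | q <- l].
  have : uniq (iota 0 (size (p ++ (r, f) :: l))) := iota_uniq _ _.
  rewrite -tags cat_uniq /= negb_or -!(mem_map (@ord_inj n)) -!map_comp.
  by case/and3P=> _ /andP[-> _] /andP[-> _].
have pr q : q \in p -> (q.1 == r) = false.
  by move=> qp; apply: contraNF rp => /eqP <-; apply: map_f.
have lr q : q \in l -> (q.1 == r) = false.
  by move=> ql; apply: contraNF rl => /eqP <-; apply: map_f.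
have actl : act (rows_word l) (clear (p ++ (r, f) :: l)) =
    clear p ++ (r, empty_row n) :: l.
  by rewrite -cat_rcons IH ?cat_rcons // /clear map_rcons cat_rcons.
rewrite /rows_word /= act_cat -/(rows_word l) actl act_blocks.
- rewrite /add_columns map_cat /= eqxx; congr (_ ++ (_, _) :: _).
  + by rewrite /clear -map_comp; apply/eq_in_map => q qp /=; rewrite pr.
  + by apply/ffunP => j; rewrite !ffunE count_columns.
  + by rewrite -[RHS]map_id; apply/eq_in_map => q ql; rewrite lr.
- apply/allP => j; rewrite -has_pred1 has_count count_columns.
  exact: supp.
- by rewrite -actl rows_from_act.
rewrite /empty_before all_cat /= ltnn /= all_map; apply/andP; split.
  by apply/allP => q _ /=; rewrite eqxx implybT.
by apply/allP => q /(rows_from_ge okl') /ltnW; rewrite leqNgt => /negPf->.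
Qed.

(** * The output word represents the product *)

Definition commutes n (u v : seq 'I_n) := chinese_eq (u ++ v) (v ++ u).

Lemma chinese_eq_catl n (u v v' : seq 'I_n) :
  chinese_eq v v' -> chinese_eq (u ++ v) (u ++ v').
Proof. by move=> h; apply: chinese_eq_cat => //; apply: chinese_eq_refl. Qed.

Lemma chinese_eq_catr n (u u' v : seq 'I_n) :
  chinese_eq u u' -> chinese_eq (u ++ v) (u' ++ v).
Proof. by move=> h; apply: chinese_eq_cat => //; apply: chinese_eq_refl. Qed.

Lemma commutes_sym n (u v : seq 'I_n) : commutes u v -> commutes v u.
Proof. exact: chinese_eq_sym. Qed.

Lemma commutes_cat n (u v w : seq 'I_n) :
  commutes u v -> commutes u w -> commutes u (v ++ w).
Proof.
move=> uv uw; rewrite /commutes catA.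
apply: chinese_eq_trans (chinese_eq_catr w uv) _.
by rewrite -!catA; apply: chinese_eq_catl.
Qed.

Lemma commutes_flatten n (T : eqType) (u : seq 'I_n) (B : T -> seq 'I_n) (s : seq T) :
  {in s, forall x, commutes u (B x)} -> commutes u (flatten (map B s)).
Proof.
elim: s => [|x s IH] h /=; first by rewrite /commutes cats0; apply: chinese_eq_refl.
apply: commutes_cat; first by apply: h; rewrite mem_head.
by apply: IH => y ys; apply: h; rewrite inE ys orbT.
Qed.

Lemma flatten_perm n (T : eqType) (B : T -> seq 'I_n) (s t : seq T) :
  (forall x y, commutes (B x) (B y)) -> perm_eq s t ->
  chinese_eq (flatten (map B s)) (flatten (map B t)).
Proof.
move=> comm; elim: s t => [|x s IH] t st.
  by rewrite perm_sym in st; rewrite (perm_nilP st); apply: chinese_eq_refl.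
have xt : x \in t by rewrite -(perm_mem st) mem_head.
case/splitPr: xt st => t1 t2; rewrite perm_sym perm_catC /= perm_cons perm_catC perm_sym.
move=> /IH h; rewrite map_cat flatten_cat /=.
apply: chinese_eq_trans (chinese_eq_catl (B x) h) _.
rewrite map_cat flatten_cat catA [X in chinese_eq _ X]catA.
by apply: chinese_eq_catr; apply: commutes_flatten.
Qed.

(** The relation [zxy = yzx] says that the pair [zx] commutes with [y]. *)
Lemma pair_commutes n (x z : 'I_n) (w : seq 'I_n) :
  all (fun y : 'I_n => (x <= y) && (y <= z)) w -> commutes [:: z; x] w.
Proof.
elim: w => [_|y w IH /= /andP[/andP[xy yz] h]].
  by rewrite /commutes cats0; apply: chinese_eq_refl.
apply: (@commutes_cat _ _ [:: y]); last exact: IH.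
by apply: chinese_eq_relator; apply: relator_zxy_yzx.
Qed.

Lemma block_commutes n (r i j : 'I_n) : commutes (block r i) (block r j).
Proof.
rewrite /block; case: ltnP => ir; case: ltnP => jr; last exact: chinese_eq_refl.
- case: (leqP i j) => ij.
    by apply: pair_commutes; rewrite /= ij; lia.
  by apply: commutes_sym; apply: pair_commutes; rewrite /=; lia.
- by apply: pair_commutes; rewrite /=; lia.
by apply: commutes_sym; apply: pair_commutes; rewrite /=; lia.
Qed.

Lemma row_word_perm n (r : 'I_n) (f : srow n) (cs : seq 'I_n) :
  (forall j, f j = count_mem j cs) ->
  chinese_eq (row_word r f) (flatten [seq block r j | j <- cs]).
Proof.
move=> fcs; apply: flatten_perm; first exact: block_commutes.
by apply/allP => j _ /=; rewrite count_columns fcs.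
Qed.

Lemma row_word_add n (r : 'I_n) (f : srow n) c :
  chinese_eq (row_word r (add_entry f c)) (block r c ++ row_word r f).
Proof.
apply: (@row_word_perm _ _ _ (c :: columns f)) => j.
by rewrite ffunE /= count_columns addnC eq_sym.
Qed.

Lemma row_word_letters n (r : 'I_n) (f : srow n) (P : pred 'I_n) :
  P r -> (forall j, 0 < f j -> P j) -> all P (row_word r f).
Proof.
move=> Pr Pf; rewrite /row_word; apply/allP => x /flatten_mapP[j].
rewrite -has_pred1 has_count count_columns /block => /Pf Pj.
by case: ifP => _; rewrite !inE; [case/orP|]; move=> /eqP->.
Qed.

Definition state_word n (g : 'I_n) (b : option 'I_n) : seq 'I_n :=
  if b is Some c then [:: g; c] else [:: g].

(** The derivation behind one iteration in which the row has an entry [m] less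
    than the incoming symbol: the pairs swap their smaller letters. *)
Lemma exchange n (g r : 'I_n) (b : option 'I_n) (m : 'I_n) :
  r < g -> below r b -> m < odflt r b ->
  chinese_eq (state_word g b ++ [:: r; m]) (block r (odflt r b) ++ [:: g; m]).
Proof.
case: b => [c|] /= rg cr mc; rewrite /block ?ltnn ?cr; last first.
  have h := relator_zyx_zxy (ltnW mc) (ltnW rg).
  apply: chinese_eq_trans (chinese_eq_relator h) _.
  by apply: chinese_eq_relator; apply: relator_zxy_yzx; lia.
(* gc.r.m = r.gcm = r.gmc = gm.rc = rc.gm *)
have comm1 : commutes [:: g; c] [:: r] by apply: pair_commutes; rewrite /=; lia.
have comm2 : commutes [:: g; m] [:: r] by apply: pair_commutes; rewrite /=; lia.
have comm3 : commutes [:: g; m] [:: r; c] by apply: pair_commutes; rewrite /=; lia.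
apply: chinese_eq_trans (chinese_eq_catr [:: m] comm1) _.
have h : chinese_eq [:: g; c; m] [:: g; m; c].
  by apply: chinese_eq_relator; apply: relator_zyx_zxy; lia.
apply: chinese_eq_trans (chinese_eq_catl [:: r] h) _.
apply: chinese_eq_trans (chinese_eq_catr [:: c] (commutes_sym comm2)) _.
exact: comm3.
Qed.

(** The outgoing pair [g m] has an interval containing every letter left in the
    row, because [m] is least: it may be moved past the row.  What remains is to
    produce it on the left of the row, which is [exchange] when [m] comes from the
    row. *)
Lemma state_word_pass n (g r : 'I_n) (f : srow n) b :
  r < g -> below r b -> (forall i : 'I_n, 0 < f i -> i <= r) ->
  chinese_eq (row_word r (residue r f b) ++ state_word g (carry r f b))
             (state_word g b ++ row_word r f).
Proof.
move=> rg br supp.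
have rK j := residueK j br supp.
case E : (carry r f b) rK => [m|] rK; last first.
  case: carryP E => // -> -> _ /=.
  have e : row_word r (empty_row n) = [::].
    rewrite /row_word (_ : columns _ = [::]) //.
    by rewrite /columns; elim: (enum _) => //= i s ->; rewrite ffunE.
  by rewrite residue_empty // e; apply: chinese_eq_refl.
have mb := carry_le E.
have [fm mmin] : 0 < add_entry f (odflt r b) m /\
    forall j : 'I_n, 0 < add_entry f (odflt r b) j -> m <= j.
  by move: E; case: carryP => // m' _ h1 h2 [<-].
have mr : m <= r by case: (b) br mb => [c|] /=; lia.
have gm (h : srow n) : (forall i : 'I_n, 0 < h i -> m <= i <= r) ->
    commutes (row_word r h) [:: g; m].
  move=> hm; apply: commutes_sym; apply: pair_commutes.
  by apply: row_word_letters => [|i /hm]; lia.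
have gmf : (forall i : 'I_n, 0 < f i -> m <= i <= r).
  by move=> i fi; rewrite supp // andbT; apply: mmin; rewrite ffunE; lia.
have [mr'|mr'] := eqVneq m r.
  (* Only diagonal entries: g joins one letter r to form the outgoing pair. *)
  subst m.
  have b0 : b = None by case: (b) br mb => //= c; lia.
  subst b; have fE : f = add_entry (residue r f None) r.
    apply/ffunP => j; have := rK j; rewrite /weight /= !ffunE eqxx /=.
    by case: (j == r) => /=; lia.
  have h : commutes (row_word r (residue r f None)) [:: g; r].
    by apply: gm => i ri; apply: gmf; rewrite fE ffunE; lia.
  apply: chinese_eq_trans h _.
  rewrite [in X in chinese_eq _ X]fE.
  apply: chinese_eq_sym.
  apply: chinese_eq_trans (chinese_eq_catl [:: g] (row_word_add _ _ _)) _.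
  by rewrite /block ltnn; apply: chinese_eq_refl.
have wE j : residue r f b j + (j == m) = f j + (j == odflt r b).
  have := rK j; rewrite /weight /= !ffunE.
  have -> : (Some m == Some r) = false by apply/eqP => -[mr2]; rewrite mr2 eqxx in mr'.
  by rewrite addn0.
have [mb'|mb'] := eqVneq m (odflt r b).
  (* The incoming symbol is itself the least, and leaves the row unchanged. *)
  have bm : b = Some m by case: (b) mb' mr' => [c -> //|/= ->]; rewrite eqxx.
  have -> : residue r f b = f by apply/ffunP => j; have := wE j; rewrite mb' => /addIn.
  by rewrite bm; apply: gm.
have mlt : m < odflt r b.
  by rewrite ltn_neqAle mb andbT; apply: contra mb' => /eqP/val_inj->.
pose h : srow n := [ffun j => f j - (j == m)].
have fE : f = add_entry h m.
  apply/ffunP => j; rewrite !ffunE subnK //; case: eqP => // ->.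
  by move: fm; rewrite ffunE (negPf mb') addn0.
have rE : residue r f b = add_entry h (odflt r b).
  by apply/ffunP => j; have := wE j; rewrite {2}fE !ffunE; lia.
have hgm : commutes (row_word r h) [:: g; m].
  by apply: gm => i hi; apply: gmf; rewrite fE ffunE; lia.
rewrite rE [in X in chinese_eq _ X]fE /=.
apply: chinese_eq_trans (chinese_eq_catr _ (row_word_add _ _ _)) _.
rewrite -catA; apply: chinese_eq_trans (chinese_eq_catl _ hgm) _.
apply: chinese_eq_sym; apply: chinese_eq_trans (chinese_eq_catl _ (row_word_add _ _ _)) _.
have mltr : m < r by rewrite ltn_neqAle mr andbT (inj_eq val_inj).
rewrite [block r m]/block mltr !catA.
by apply: chinese_eq_catr; apply: exchange.
Qed.

Lemma rows_word_insert n k (g : 'I_n) b l :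
  k <= g -> below k b -> rows_from k l ->
  chinese_eq (rows_word (insert g b l)) (state_word g b ++ rows_word l).
Proof.
elim: l k b => [|[r f] l IH] k b kg bk okl.
  by move: okl kg => /= /eqP->; have := ltn_ord g; lia.
have [kr supp okl'] := rows_from_cons okl; subst k.
have [rg|gr] := ltnP r g.
  rewrite /= rg /rows_word /= -!/(rows_word _).
  have h := IH r.+1 (carry r f b) rg (carry_below f bk) okl'.
  apply: chinese_eq_trans (chinese_eq_catl _ h) _.
  by rewrite !catA; apply: chinese_eq_catr; apply: state_word_pass.
have {gr kg} rg : r = g by apply/val_inj/eqP; rewrite eqn_leq kg.
subst r; rewrite /= ltnn eqxx /rows_word /= catA; apply: chinese_eq_catr.
apply: chinese_eq_trans (row_word_add _ _ _) _; apply: chinese_eq_catr.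
rewrite /block; case: b bk => [c|] /= => [->|_]; rewrite ?ltnn; exact: chinese_eq_refl.
Qed.

(** * The algorithm on matrices *)

Definition row_at n (s : 'M[nat]_n) (k : 'I_n) : srow n := [ffun j => s k j].

Definition rows_of n (s : 'M[nat]_n) (ks : seq 'I_n) : srows n :=
  [seq (k, row_at s k) | k <- ks].

Lemma staircase_supp n (s : 'M[nat]_n) :
  chinese_staircase s -> forall k j : 'I_n, 0 < row_at s k j -> j <= k.
Proof.
move=> /is_trig_mxP hs k j; rewrite ffunE => sj; rewrite leqNgt.
by apply/negP => kj; move: sj; rewrite (hs _ _ kj).
Qed.

Lemma rightmost_nonzeroE n (s : 'M[nat]_n) (r : 'I_n) :
  rightmost_nonzero s r = lowest (row_at s r).
Proof.
apply: eq_pick => e; rewrite ffunE; congr andb.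
by apply: eq_forallb => j; rewrite ffunE.
Qed.

(** The algorithm inspects the row before the incoming symbol is added, and
    [carry] after.  The least entry of the enlarged row is either the one that
    the algorithm finds or a proper incoming symbol, and in the latter case the
    algorithm leaves the row alone. *)
Lemma process_rowE n (r : 'I_n) (b : option 'I_n) (s : 'M[nat]_n) :
  below r b -> (forall j : 'I_n, 0 < row_at s r j -> j <= r) ->
  exists s', [/\ process_row r b s = (carry r (row_at s r) b, s'),
    row_at s' r = residue r (row_at s r) b
    & forall k, k != r -> row_at s' k = row_at s k].
Proof.
move=> br supp; rewrite /process_row rightmost_nonzeroE.
have upd f (c k : 'I_n) t : k != r -> row_at (update_entry f r c t) k = row_at t k.
  by move=> kr; apply/ffunP => j; rewrite !ffunE mxE (negPf kr).
have updr f (c : 'I_n) t j :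
    row_at (update_entry f r c t) r j = if j == c then f (t r j) else t r j.
  by rewrite ffunE mxE eqxx.
case: lowestP => [s0|e fe emin].
  rewrite s0; exists s; split=> //; last by rewrite residue_empty.
  by rewrite carry_empty.
case: b br => [c|] /= br; last first.
  have ce : carry r (row_at s r) None = Some e.
    rewrite /carry ifF /=.
      apply: lowestE => [|j]; rewrite ffunE; first by rewrite ltn_addr.
      by case: eqP => [-> _|_]; [exact: supp|rewrite addn0; exact: emin].
    by apply/eqP => s0; rewrite s0 ffunE in fe.
  case: (ltngtP e r) (supp e fe) => // er _; rewrite ce; eexists; split=> //.
  - apply/ffunP => j; rewrite [RHS]ffunE ce /weight /= updr mxE eqxx /= !ffunE.
    have -> : (Some e == Some r) = false by apply/eqP => -[E]; rewrite E ltnn in er.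
    rewrite /= addn0; case: (eqVneq j e) => [->|je].
      have -> : (e == r) = false by apply/eqP => E; rewrite E ltnn in er.
      lia.
    by case: (j == r) => /=; lia.
  - by move=> k kr; rewrite !upd.
  - move/val_inj: er => er; subst e.
    apply/ffunP => j; rewrite [RHS]ffunE ce /weight /= updr eqxx /= !ffunE.
    by case: (j == r) => /=; lia.
  - by move=> k kr; rewrite !upd.
have [ec|ce] := ltnP e c.
  have cr : carry r (row_at s r) (Some c) = Some e.
    rewrite /carry /=; apply: lowestE => [|j]; rewrite ffunE; first by rewrite ltn_addr.
    by case: eqP => [-> _|_]; [exact: ltnW|rewrite addn0; exact: emin].
  rewrite cr; eexists; split=> //; last by move=> k kr; rewrite !upd.
  apply/ffunP => j; rewrite [RHS]ffunE cr /weight /= updr mxE eqxx /= !ffunE.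
  have -> : (Some e == Some r) = false by apply/eqP => -[E]; move: ec br; rewrite E; lia.
  rewrite /= addn0; case: (eqVneq j e) => [->|je].
    have -> : (e == c) = false by apply/eqP => E; rewrite E ltnn in ec.
    lia.
  by case: (j == c) => /=; lia.
have cr : carry r (row_at s r) (Some c) = Some c.
  rewrite /carry /=; apply: lowestE => [|j]; rewrite ffunE ?eqxx ?addn1 //.
  by case: eqP => [-> //|_]; rewrite addn0 => /emin; apply: leq_trans.
rewrite cr; eexists; split=> //.
apply/ffunP => j; rewrite [RHS]ffunE cr /weight /=.
have -> : (Some c == Some r) = false by apply/eqP => -[E]; move: br; rewrite E ltnn.
by rewrite addn0 !ffunE addnK.
Qed.

Lemma run_insert n (g : 'I_n) rs post (b : option 'I_n) (s : 'M[nat]_n) k :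
  rows_from k (rows_of s (rs ++ g :: post)) -> below k b ->
  exists t, [/\ exists i, iter i (step g) (Running rs b s) = Halted t,
    rows_of t (rs ++ g :: post) = insert g b (rows_of s (rs ++ g :: post))
    & forall j, j \notin rs ++ g :: post -> row_at t j = row_at s j].
Proof.
elim: rs k b s => [|r rs IH] k b s okl bk.
  exists (process_last_row g b s); split; first by exists 1.
  - have [? _ okp] := rows_from_cons okl; subst k.
    rewrite /= ltnn eqxx; congr ((_, _) :: _).
      apply/ffunP => j; case: b bk => [c|] _ /=; rewrite /add_entry !ffunE mxE eqxx /=;
        by case: eqP; rewrite ?addn1 ?addn0.
    apply/eq_in_map => j jp; congr pair; apply/ffunP => i.
    have gj : j == g = false.
      apply/negbTE; apply: contraNneq (rows_from_notin okp (ltnSn g)) => <-.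
      by rewrite -map_comp map_id.
    by case: b bk => [c|] _ /=; rewrite !ffunE mxE gj.
  move=> j; rewrite /= inE negb_or => /andP[/negPf gj _]; apply/ffunP => i.
  by case: b bk => [c|] _ /=; rewrite !ffunE mxE gj.
have [? supp okl'] := rows_from_cons okl; subst k.
have [s' [Ep Er Es]] := process_rowE bk supp.
have rnotin : r \notin rs ++ g :: post.
  have := rows_from_notin okl' (ltnSn r).
  by rewrite -map_comp map_id.
have Erows : rows_of s' (rs ++ g :: post) = rows_of s (rs ++ g :: post).
  apply/eq_in_map => j jin; rewrite Es //.
  by apply: contraNneq rnotin => <-.
have rg : r < g.
  apply: (@rows_from_ge _ _ _ (g, row_at s g) okl').
  by apply: map_f; rewrite mem_cat mem_head orbT.
have [||t [[i Hi] Et Ej]] := IH r.+1 (carry r (row_at s r) b) s'.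
- by rewrite Erows.
- exact: carry_below.
exists t; split.
- by exists i.+1; rewrite iterSr /= Ep.
- by rewrite /= rg Ej // Er -Erows; congr cons.
move=> j; rewrite /= inE negb_or => /andP[jr jin].
by rewrite Ej // Es.
Qed.

Lemma enum_split n (g : 'I_n) : exists post : seq 'I_n,
  [/\ enum 'I_n = [seq r : 'I_n <- enum 'I_n | r < g] ++ g :: post
    & forall j, j \in post -> g < j].
Proof.
have srt : sorted ltn (map val (enum 'I_n)) by rewrite val_enum_ord iota_ltn_sorted.
have gin : g \in enum 'I_n by rewrite mem_enum.
move: srt; case/splitPr: gin => p1 p2.
rewrite sorted_pairwise; last exact: ltn_trans.
rewrite pairwise_map pairwise_cat /= => /and4P[p1g _ gp2 _].
exists p2; split; last by move=> j /(allP gp2).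
have lt1 j : j \in p1 -> j < g by move=> /(allP p1g) /andP[].
rewrite filter_cat /= ltnn (all_filterP _) ?(eq_in_filter (a2 := pred0)).
- by rewrite filter_pred0 cats0.
- by move=> j /(allP gp2) /= gj; rewrite ltnNge ltnW.
by apply/allP.
Qed.

Lemma staircase_row_wordE n (s : 'M[nat]_n) (k : 'I_n) :
  chinese_staircase s -> staircase_row_word s k = row_word k (row_at s k).
Proof.
move=> hs; rewrite /row_word /columns.
have -> (es : seq 'I_n) :
    flatten [seq block k j | j <- flatten [seq nseq (row_at s k j) j | j <- es]] =
    flatten [seq flatten (nseq (s k j) (block k j)) | j <- es].
  elim: es => //= j es <-; rewrite map_cat flatten_cat map_nseq.
  by rewrite ffunE.
rewrite /staircase_row_word; have [post [E kpost]] := enum_split k.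
rewrite [in RHS]E map_cat flatten_cat /=; congr (_ ++ _).
  congr flatten; apply/eq_in_map => j; rewrite mem_filter => /andP[jk _].
  by rewrite /block jk.
have -> : flatten [seq flatten (nseq (s k j) (block k j)) | j <- post] = [::].
  elim: post kpost {E} => //= j post IH kpost; rewrite IH ?cats0; last first.
    by move=> i ip; apply: kpost; rewrite inE ip orbT.
  by move/is_trig_mxP: hs => -> //; apply: kpost; rewrite mem_head.
by rewrite cats0 /block ltnn; elim: (s k k) => //= d <-.
Qed.

Lemma staircase_wordE n (s : 'M[nat]_n) :
  chinese_staircase s -> staircase_word s = rows_word (rows_of s (enum 'I_n)).
Proof.
move=> hs; rewrite /staircase_word /rows_word /rows_of -map_comp; congr flatten.
by apply: eq_map => k; apply: staircase_row_wordE.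
Qed.

Lemma rows_from_supp n k (l : srows n) r f :
  rows_from k l -> (r, f) \in l -> forall j : 'I_n, 0 < f j -> j <= r.
Proof.
elim: l k => // -[r' f'] l IH k /rows_from_cons[_ supp /IH{}IH].
by rewrite inE => /orP[/eqP[-> ->]|/IH].
Qed.

Lemma rows_from_rows_of n (s : 'M[nat]_n) :
  rows_from 0 (rows_of s (enum 'I_n)) = chinese_staircase s.
Proof.
apply/idP/idP => [okl|hs].
  apply/is_trig_mxP => i j ij; apply/eqP; rewrite -leqn0 leqNgt; apply/negP => sij.
  have iin : (i, row_at s i) \in rows_of s (enum 'I_n).
    by apply: map_f; rewrite mem_enum.
  have sij' : 0 < row_at s i j by rewrite ffunE.
  by have := rows_from_supp okl iin sij'; rewrite leqNgt ij.
have main m : forall k (es : seq 'I_n),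
    map val es = iota k m -> k + m = n -> rows_from k (rows_of s es).
  elim: m => [|m IH] k [|i es] //=; first by rewrite addn0 => _ ->.
  case=> ik esE km; rewrite ik eqxx IH ?andbT //; last by rewrite addSnnS.
  by apply/forallP => j; apply/implyP => sj; rewrite -ik; apply: staircase_supp hs _ _ sj.
by apply: (main n); rewrite ?val_enum_ord.
Qed.

(** Congruent words act alike, and each of these two rebuilds its own staircase
    from the empty one. *)
Lemma staircase_word_inj n (s t : 'M[nat]_n) :
  chinese_staircase s -> chinese_staircase t ->
  chinese_eq (staircase_word s) (staircase_word t) -> s = t.
Proof.
move=> hs ht; rewrite !staircase_wordE // => st.
have cl u : clear (rows_of u (enum 'I_n)) = [seq (k, empty_row n) | k <- enum 'I_n].
  by rewrite /clear -map_comp.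
have rs := hs; have rt := ht; rewrite -rows_from_rows_of in rs; rewrite -rows_from_rows_of in rt.
have := act_chinese_eq st (rows_from_clear rs).
rewrite (@act_rows_word _ [::]) // cl -(cl t) (@act_rows_word _ [::]) //= => E.
apply/matrixP => i j.
have /eq_in_map/(_ i) : rows_of s (enum 'I_n) = rows_of t (enum 'I_n) by [].
by rewrite mem_enum => /(_ isT) [/ffunP/(_ j)]; rewrite !ffunE.
Qed.

Theorem proposition3p6 (n : nat) (hn : 1 <= n) (s : 'M[nat]_n)
    (hs : chinese_staircase s) (g : 'I_n) :
  exists t : 'M[nat]_n,
    [/\ halts_with_output s g t,
        chinese_staircase t,
        chinese_eq (staircase_word t) (g :: staircase_word s)
      & forall t' : 'M[nat]_n, chinese_staircase t' ->
          chinese_eq (staircase_word t') (g :: staircase_word s) -> t' = t].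
Proof.
have [post [E _]] := enum_split g.
have okl := hs; rewrite -rows_from_rows_of in okl.
have okl' := okl; rewrite E in okl'.
have [//|t [halts Et _]] := run_insert (b := None) okl'.
rewrite -E in Et.
have ht : chinese_staircase t.
  by rewrite -rows_from_rows_of Et; apply: rows_from_insert.
have wt : chinese_eq (staircase_word t) (g :: staircase_word s).
  rewrite !staircase_wordE // Et.
  exact: (@rows_word_insert _ 0 g None).
exists t; split=> // t' ht' wt'; apply: staircase_word_inj => //.
exact: chinese_eq_trans wt' (chinese_eq_sym wt).
Qed.
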